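(* The number of cops needed to win the cops-and-robber game with a robber-monotone strategy is not closed under taking butterfly minors: there exist finite simple digraphs $D$ and $D'$, with $D'$ a butterfly minor of $D$, and an integer $k$ such that $k$ cops have a robber-monotone winning strategy on $D$ but $k$ cops have no robber-monotone winning strategy on $D'$.
   Context: A butterfly minor of $D$ is a digraph obtained from a subgraph of $D$ by contracting edges $(u,v)$ that are the only edge with tail $u$ or the only edge with head $v$. Cops-and-robber game on a digraph $D$: a position is a pair $(C,v)$ with $C\subseteq V(D)$ the cop position and $v\in V(D)$ the robber position; the start position is $(\emptyset,v_0)$ with $v_0$ chosen by the robber. In each round from position $(C,v)$, the cops announce a new position $C'$; the robber moves to any vertex $v'$ in the same strong component of $D-(C\cap C')$ as $v$; then the cops are placed on $C'$, giving position $(C',v')$. A strategy for $k$ cops is a function assigning to each position $(C,v)$ with $|C|\le k$ a new cop position of size at most $k$; a play is consistent with it if each new cop position is the value of the strategy on the previous position. The cops win a play if $v_i\in C_i$ for some $i$; a strategy is winning if the cops win every consistent play. For a play $(C_0,v_0),(C_1,v_1),\dots$ the robber spaces are $R_0=V(D)$ and, for $i\ge1$, $R_i$ is the strong component of $D-C_i$ containing $v_i$ (so that $R_{i-1}$ and $R_i$ lie in the same strong component of $D-(C_{i-1}\cap C_i)$). A play is robber-monotone if $R_i\supseteq R_{i+1}$ for all $i$; a strategy is robber-monotone if every consistent play is robber-monotone. *)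

(* Defs.v *)
From HB Require Import structures.
From mathcomp Require Import all_boot.

Set Implicit Arguments.
Unset Strict Implicit.
Unset Printing Implicit Defensive.

(* Finite simple digraphs: no loops and no parallel edges, but the two edges
   (x, y) and (y, x) may both be present. *)
Record digraph := Digraph {
  vertex :> finType;
  edge : rel vertex;
  edge_irr : irreflexive edge
}.

(* H is isomorphic to a (not necessarily induced) subgraph of D. *)
Definition subgraph (H D : digraph) : Prop :=
  exists f : H -> D,
    injective f /\ (forall x y : H, edge x y -> edge (f x) (f y)).

Definition butterfly_edge (D : digraph) (u v : D) : Prop :=
  edge u v /\
  ((forall w : D, edge u w -> w = v) \/ (forall w : D, edge w v -> w = u)).

(* D' is, up to isomorphism, D with u and v identified, where phi is the
   quotient map. Digraphs being simple, the loops that arise are dropped and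
   parallel edges are merged. *)
Definition contraction (D : digraph) (u v : D) (D' : digraph) : Prop :=
  exists phi : D -> D',
    [/\ forall a : D', exists x : D, phi x = a,
        forall x y : D, phi x = phi y <->
          [\/ x = y, x = u /\ y = v | x = v /\ y = u]
      & forall a b : D', edge a b <->
          a <> b /\ exists x y : D, [/\ phi x = a, phi y = b & edge x y]].

(* Each contracted edge has to be a butterfly edge of the digraph reached so
   far. *)
Inductive butterfly_contracts (D : digraph) : digraph -> Prop :=
| butterfly_contracts_refl : butterfly_contracts D D
| butterfly_contracts_step (H H' : digraph) (u v : H) :
    butterfly_contracts D H -> butterfly_edge u v -> contraction u v H' ->
    butterfly_contracts D H'.

Definition butterfly_minor (D' D : digraph) : Prop :=
  exists H : digraph, subgraph H D /\ butterfly_contracts H D'.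

Section Game.
Variable D : digraph.

Definition edge_minus (X : {set D}) : rel D :=
  [rel x y | [&& x \notin X, y \notin X & edge x y]].

(* The strong component of D - X containing v; empty if v is in X. *)
Definition strong_component (X : {set D}) (v : D) : {set D} :=
  [set w | [&& v \notin X, w \notin X,
     connect (edge_minus X) v w & connect (edge_minus X) w v]].

Definition position : Type := ({set D} * D)%type.

Definition captured (p : position) : bool := p.2 \in p.1.

Definition legal_round (p q : position) : Prop :=
  q.2 \in strong_component (p.1 :&: q.1) p.2.

(* A play stops as soon as the robber is captured; such a finite play is
   represented by the infinite sequence that repeats its last position. *)
Definition play (p : nat -> position) : Prop :=
  (p 0).1 = set0 /\
  forall i : nat,
    if captured (p i) then p i.+1 = p i else legal_round (p i) (p i.+1).

Definition cops_win (p : nat -> position) : Prop := exists i, captured (p i).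

Definition robber_space (p : nat -> position) (i : nat) : {set D} :=
  if i is 0 then setT else strong_component (p i).1 (p i).2.

Definition robber_monotone_play (p : nat -> position) : Prop :=
  forall i : nat, robber_space p i.+1 \subset robber_space p i.

(* Only the values of f at positions with at most k cops matter. *)
Definition strategy (k : nat) (f : position -> {set D}) : Prop :=
  forall p : position, #|p.1| <= k -> #|f p| <= k.

Definition consistent (f : position -> {set D}) (p : nat -> position) : Prop :=
  forall i : nat, ~~ captured (p i) -> (p i.+1).1 = f (p i).

Definition winning (f : position -> {set D}) : Prop :=
  forall p : nat -> position, play p -> consistent f p -> cops_win p.

Definition robber_monotone (f : position -> {set D}) : Prop :=
  forall p : nat -> position,
    play p -> consistent f p -> robber_monotone_play p.

End Game.

Definition robber_monotone_win (k : nat) (D : digraph) : Prop :=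
  exists f : position D -> {set D},
    [/\ strategy k f, winning f & robber_monotone f].

(* Main.v *)
(* D is the digraph on 0..7 given by [split_edges]; the only edge into 7 is
   (4, 7), and D' merges 7 into 4. On D, three cops on 0, 3, 7 leave the strong
   components {1, 4, 6}, {2} and {5}. Against {1, 4, 6} the cop on 7 only guards
   the way out 4 -> 7 -> {2, 3} and leaves 4 to the robber: once 3 has been
   exchanged for 5 the robber can no longer return from 7, so the cop on 7 is
   free to go. On D' this guard has to stand on 4, where the robber returns as
   soon as it is lifted, and no detour exists: there is a set of positions of at
   most three cops, containing the start, in which the robber survives every
   addition or removal of one cop, unless the removed cop's vertex becomes part
   of the robber space again. *)
Require Import Defs.
From mathcomp Require Import all_boot.

Set Implicit Arguments.
Unset Strict Implicit.
Unset Printing Implicit Defensive.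

(** * Sufficient conditions for a cop win and for a robber win *)

Section GameCertificates.
Variables (D : digraph) (k : nat).

Lemma strong_component_captured (X : {set D}) v :
  v \in X -> strong_component X v = set0.
Proof. by move=> vX; apply/setP=> w; rewrite !inE vX. Qed.

Lemma mem_strong_component (X : {set D}) v :
  v \notin X -> v \in strong_component X v.
Proof. by move=> vX; rewrite !inE vX !connect0. Qed.

(** A falling rank leaves no infinite play without capture, and monotonicity is a condition on
    single rounds. Only rounds that end without capture matter, as a captured robber has an empty
    space. *)
Lemma robber_monotone_winI (f : position D -> {set D})
    (inv : pred (position D)) (rank : position D -> nat) :
  (forall p, #|f p| <= k) ->
  (forall v, inv (set0, v)) ->
  (forall p v, inv p -> v \in strong_component (p.1 :&: f p) p.2 ->
     v \notin f p ->
     [/\ inv (f p, v), rank (f p, v) < rank p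
       & strong_component (f p) v \subset strong_component p.1 p.2]) ->
  robber_monotone_win k D.
Proof.
move=> fk inv0 invS; exists f; split=> [p _ | p play_p cons_p | p play_p cons_p].
- exact: fk.
- have [p0 pS] := play_p.
  suff win_from r i : rank (p i) < r -> inv (p i) -> cops_win p.
    apply: (win_from (rank (p 0)).+1 0) => //.
    by case: (p 0) p0 => C v /= ->.
  elim: r i => // r IHr i le_r inv_i.
  have [cap_i | ncap_i] := boolP (captured (p i)); first by exists i.
  have [cap_i1 | ncap_i1] := boolP (captured (p i.+1)); first by exists i.+1.
  have := pS i; rewrite (negbTE ncap_i) /legal_round (cons_p i ncap_i) => legal_i.
  have pi1 : p i.+1 = (f (p i), (p i.+1).2).
    by rewrite -(cons_p i ncap_i); case: (p i.+1).
  move: ncap_i1; rewrite pi1 /captured /= => ncap_i1.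
  have [inv_i1 lt_i1 _] := invS _ _ inv_i legal_i ncap_i1.
  rewrite -pi1 in inv_i1 lt_i1.
  by apply: IHr inv_i1; apply: leq_trans lt_i1 _.
have [p0 pS] := play_p.
have step i : inv (p i) -> ~~ captured (p i) -> ~~ captured (p i.+1) ->
    inv (p i.+1) /\
    strong_component (p i.+1).1 (p i.+1).2 \subset
      strong_component (p i).1 (p i).2.
  move=> inv_i ncap_i; have := pS i; rewrite (negbTE ncap_i) /legal_round.
  have := cons_p i ncap_i; case: (p i.+1) => C v /= -> legal_i ncap_i1.
  by have [] := invS _ _ inv_i legal_i ncap_i1.
have capS i : captured (p i) -> captured (p i.+1).
  by move=> cap_i; have := pS i; rewrite cap_i => ->.
have inv_p i : ~~ captured (p i) -> inv (p i).
  elim: i => [|i IHi] ncap; first by case: (p 0) p0 => C v /= ->.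
  have ncap_i : ~~ captured (p i) by apply: contra ncap; apply: capS.
  by have [] := step i (IHi ncap_i) ncap_i ncap.
(* R_0 is the whole vertex set by convention, so the first inclusion is trivial. *)
case=> [|i]; first exact: subsetT.
have [cap | ncap] := boolP (captured (p i.+2)).
  by rewrite /robber_space (strong_component_captured cap) sub0set.
have ncap_i : ~~ captured (p i.+1) by apply: contra ncap; apply: capS.
by have [] := step i.+1 (inv_p _ ncap_i) ncap_i ncap.
Qed.

Lemma strong_component_anti (X Y : {set D}) v :
  X \subset Y -> strong_component Y v \subset strong_component X v.
Proof.
move=> XY; have sub_edge : subrel (edge_minus Y) (connect (edge_minus X)).
  move=> x y /and3P[xY yY xy]; apply: connect1; rewrite /edge_minus /= xy.
  by rewrite !(contra (subsetP XY _)).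
apply/subsetP=> w; rewrite !inE => /and4P[vY wY vw wv].
rewrite !(contra (subsetP XY _)) //=.
by rewrite !(connect_sub sub_edge).
Qed.

Lemma strong_component_trans (X : {set D}) u v w :
  v \in strong_component X u -> w \in strong_component X v ->
  w \in strong_component X u.
Proof.
rewrite !inE => /and4P[-> _ uv vu] /and4P[_ -> vw wv].
by rewrite (connect_trans uv vw) (connect_trans wv vu).
Qed.

(* A lifted cop whose vertex the robber reaches breaks monotonicity, since the
   robber may go there; all other rounds are sequences of drops and additions
   of single cops. *)
Lemma not_robber_monotone_winI (trap : position D -> bool) (v0 : D) :
  trap (set0, v0) ->
  strong_component set0 v0 = setT ->
  (forall (C : {set D}) v, trap (C, v) -> v \notin C) ->
  (forall (C : {set D}) v c, c \in C -> trap (C, v) ->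
     c \in strong_component (C :\ c) v \/ trap (C :\ c, v)) ->
  (forall (C : {set D}) v c, c \notin C -> #|C| < k -> trap (C, v) ->
     exists2 w, w \in strong_component C v & trap (c |: C, w)) ->
  ~ robber_monotone_win k D.
Proof.
move=> trap0 conn0 trapN trap_drop trap_add [f [fk f_win f_mono]].
(* An arbitrary round from B to C: the robber stays in the trap or makes his space gain a vertex.
   Its cop changes are ordered as lifts down to I = B ∩ C followed by placements up to C. *)
have trapS p (C : {set D}) : trap p -> #|C| <= k ->
    exists2 v, v \in strong_component (p.1 :&: C) p.2
      & trap (C, v) ||
        ~~ (strong_component C v \subset strong_component p.1 p.2).
  case: p => B u /= trap_p Ck; set I := B :&: C.
  have [/exists_inP[c c_lift c_in] | no_lift] :=
      boolP [exists c in B :\: C, c \in strong_component I u].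
    (* The robber moves to c: it lies outside C, hence in the new space, but inside B, hence not in
       the old one. *)
    exists c => //; apply/orP; right; apply/subsetPn; exists c.
      by apply: mem_strong_component; case/setDP: c_lift.
    by rewrite !inE; case/setDP: c_lift => ->; rewrite andbF.
  have uI : u \notin I by rewrite inE negb_and (trapN _ _ trap_p).
  (* Lifts happen one at a time with the robber at rest. If he reached the freed c while S minus c
     is guarded, he would also reach it in D - I, against [no_lift]. *)
  have drop m (S : {set D}) : #|S :\: C| <= m -> S :&: C = I -> S \subset B ->
      trap (S, u) -> trap (I, u).
    elim: m S => [|m IHm] S.
      rewrite leqn0 cards_eq0 setD_eq0 => /setIidPl-> -> //.
    move=> Sm SC SB trap_S.
    have [S0 | [c c_SC]] := set_0Vmem (S :\: C).
      by apply: (IHm S) => //; rewrite S0 cards0.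
    have [cS cC] := setDP c_SC.
    apply: (IHm (S :\ c)).
    - rewrite -ltnS (leq_trans _ Sm) // setDDl setUC -setDDl.
      exact: proper_card (properD1 c_SC).
    - by rewrite -SC; apply/setP=> x; rewrite !inE; case: eqP => // ->;
        rewrite (negbTE cC) !andbF.
    - by apply: subset_trans SB; apply: subD1set.
    have [c_in | //] := trap_drop _ _ _ cS trap_S.
    have IS : I \subset S :\ c.
      by rewrite subsetD1 -SC subsetIl inE (negbTE cC) andbF.
    case/negP: no_lift; apply/exists_inP; exists c.
      by rewrite inE cC (subsetP SB).
    exact: subsetP (strong_component_anti _ IS) _ c_in.
  (* The robber may move at each placement. All these moves stay in one strong component of D - I,
     so together they form a single legal move. *)
  have add m (S : {set D}) v : #|C :\: S| <= m -> I \subset S -> S \subset C ->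
      v \in strong_component I u -> trap (S, v) ->
      exists2 w, w \in strong_component I u & trap (C, w).
    elim: m S v => [|m IHm] S v.
      rewrite leqn0 cards_eq0 setD_eq0 => CS _ SC v_in trap_S.
      by exists v; rewrite // (_ : C = S) //; apply/eqP; rewrite eqEsubset CS.
    move=> Sm IS SC v_in trap_S.
    have [S0 | [c c_CS]] := set_0Vmem (C :\: S).
      by apply: (IHm S v) => //; rewrite S0 cards0.
    have [cC cS] := setDP c_CS.
    have Sk : #|S| < k.
      apply: leq_trans Ck; apply: proper_card; apply/properP; split=> //.
      by exists c.
    have [w w_in trap_w] := trap_add _ _ _ cS Sk trap_S.
    apply: (IHm (c |: S) w) trap_w.
    - rewrite -ltnS (leq_trans _ Sm) // setUC -setDDl.
      exact: proper_card (properD1 c_CS).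
    - exact: subset_trans IS (subsetUr _ _).
    - by rewrite subUset sub1set cC.
    apply: strong_component_trans v_in _.
    exact: subsetP (strong_component_anti _ IS) _ w_in.
  have trap_I : trap (I, u) by apply: (drop _ B (leqnn _)).
  have [w w_in trap_w] := add _ I u (leqnn _) (subxx _) (subsetIr _ _)
    (mem_strong_component uI) trap_I.
  by exists w; rewrite ?trap_w.
pose good (p : position D) v :=
  (v \in strong_component (p.1 :&: f p) p.2) &&
  (trap (f p, v) ||
   ~~ (strong_component (f p) v \subset strong_component p.1 p.2)).
(* Without a good move the robber stays put, so that the sequence is a play. *)
pose next p := if captured p then p else (f p, odflt p.2 [pick v | good p v]).
pose p i := iter i next (set0, v0).
have pS i : p i.+1 = next (p i) by [].
have play_p : play p.
  split=> // i; case: ifP => cap; first by rewrite pS /next cap.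
  rewrite /legal_round pS /next cap /=; case: pickP => [v /andP[] // | _] /=.
  by apply: mem_strong_component; rewrite inE negb_and; move: cap => /negbT->.
have cons_p : consistent f p.
  by move=> i ncap; rewrite pS /next (negbTE ncap).
(* At index 0 the space is everything by convention, which agrees with the strong component by
   [conn0]. *)
have space_p i :
    trap (p i) -> robber_space p i = strong_component (p i).1 (p i).2.
  by case: i.
have trap_p i : trap (p i) /\ #|(p i).1| <= k.
  elim: i => [|i [trap_i k_i]]; first by rewrite /= cards0.
  have ncap : ~~ captured (p i) by rewrite /captured trapN // -surjective_pairing.
  have k_i1 : #|f (p i)| <= k by apply: fk.
  have p_i1 : p i.+1 = (f (p i), odflt (p i).2 [pick v | good (p i) v]).
    by rewrite pS /next (negbTE ncap).
  have [v v_in v_good] := trapS _ _ trap_i k_i1.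
  (* Monotonicity of the strategy rules out the second alternative of [good], so the play remains in
     the trap. *)
  have := f_mono _ play_p cons_p i; rewrite (space_p i trap_i) /= -/(p i) -pS p_i1.
  case: pickP => [w /andP[w_in w_good] /= sub | /(_ v)]; last first.
    by rewrite /good v_in v_good.
  by move: w_good; rewrite sub orbF.
have [i] := f_win _ play_p cons_p.
by apply/negP; rewrite /captured trapN // -surjective_pairing; case: (trap_p i).
Qed.

End GameCertificates.

(** * Strong components and certificates as computations on lists of naturals *)

Section FiniteGraphs.
Variables (n : nat) (E : seq (nat * nat)).

(** The test [i != j] discards the loops that merging two vertices leaves in an edge list. *)
Definition arc : rel nat := fun i j => (i != j) && ((i, j) \in E).

Definition graph_edge : rel 'I_n := fun x y => arc x y.

Lemma graph_edge_irr : irreflexive graph_edge.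
Proof. by move=> x; rewrite /graph_edge /arc eqxx. Qed.

Definition graph : digraph := Digraph graph_edge_irr.

Definition vset (s : seq nat) : {set graph} := [set x : 'I_n | val x \in s].

Lemma card_vset s : #|vset s| <= size s.
Proof.
rewrite cardE -(size_map val); apply: uniq_leq_size.
  by rewrite (map_inj_uniq val_inj) enum_uniq.
by move=> i /mapP[x]; rewrite mem_enum inE => x_s ->.
Qed.

Lemma vset_filter s t : vset s :&: vset t = vset [seq i <- s | i \in t].
Proof. by apply/setP=> x; rewrite !inE mem_filter andbC. Qed.

Definition free (X : seq nat) : seq nat := [seq i <- iota 0 n | i \notin X].

Definition grow (e : rel nat) X (S : seq nat) : seq nat :=
  [seq j <- free X | (j \in S) || has (fun i => e i j) S].

(** Here [n] rounds suffice, since a path without repeated vertices has fewer than [n] edges. *)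
Definition reach (e : rel nat) X i : seq nat := iter n (grow e X) [:: i].

Definition component (X : seq nat) (i : nat) : seq nat :=
  if i \in X then [::] else
  let fwd := reach arc X i in let bwd := reach (fun a b => arc b a) X i in
  [seq j <- free X | (j \in fwd) && (j \in bwd)].

Lemma mem_free X (x : 'I_n) : (val x \in free X) = (val x \notin X).
Proof. by rewrite mem_filter mem_iota /= add0n (ltn_ord x) andbT. Qed.

Lemma reachP (e : rel nat) (X : seq nat) (x y : 'I_n) : val x \notin X ->
  (val y \in reach e X x) =
  connect [rel a b : 'I_n | [&& val a \notin X, val b \notin X & e a b]] x y.
Proof.
move=> xX; set r := [rel a b : 'I_n | _].
have sound m j : j \in iter m (grow e X) [:: val x] ->
    exists z : 'I_n, [/\ val z = j, j \notin X & connect r x z].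
  elim: m j => [|m IHm] j /=; first by rewrite inE => /eqP->; exists x.
  rewrite mem_filter => /andP[/orP[/IHm // | /hasP[i /IHm[z [zi iX xz]] eij]]].
  rewrite mem_filter mem_iota /= => /andP[jX jn]; exists (Ordinal jn).
  split=> //; apply: connect_trans xz _; apply: connect1.
  by rewrite /= zi iX jX eij.
have complete m p : path r x p -> size p <= m ->
    val (last x p) \in iter m (grow e X) [:: val x].
  elim: m p => [|m IHm] p; first by case: p => //= _ _; rewrite mem_seq1.
  case/lastP: p => [|p z] p_path /= sz_p; rewrite mem_filter.
    by rewrite (IHm [::]) //= mem_free.
  move: p_path sz_p; rewrite last_rcons rcons_path size_rcons mem_free.
  move=> /andP[p_path /and3P[_ -> ez]] sz_p; rewrite andbT.
  by apply/orP; right; apply/hasP; exists (val (last x p)); first exact: IHm.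
apply/idP/connectP=> [/sound[z [/val_inj <- _ /connectP//]] | [p p_path ->]].
case/shortenP: p_path => q q_path uq _; apply: complete => //.
by have := max_card (mem (x :: q)); rewrite card_ord (card_uniqP uq) => /ltnW.
Qed.

Lemma componentP (X : seq nat) (x : 'I_n) :
  strong_component (vset X) (x : graph) = vset (component X x).
Proof.
apply/setP=> w; rewrite !inE /component.
case: ifPn => [//|xX]; rewrite mem_filter mem_free andbC andbT !reachP //.
rewrite [RHS]andbC; congr [&& _, _ & _].
  by apply: eq_connect => a b; rewrite /edge_minus /= !inE.
(* Reaching x from w amounts to reaching w from x in the reversed digraph, which is what the
   backward search computes. *)
have := connect_rev (@edge_minus graph (vset X)) x w => /= <-.
by apply: eq_connect => a b; rewrite /edge_minus /= !inE andbCA.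
Qed.

Lemma component_sub X i j : j \in component X i -> j < n.
Proof.
rewrite /component; case: ifP => // _.
by rewrite !mem_filter mem_iota => /andP[_ /andP[_]].
Qed.

Lemma vset_sub s t : {in s, forall i, i < n} ->
  (vset s \subset vset t) = all (mem t) s.
Proof.
move=> s_n; apply/subsetP/allP => [st i i_s | st x].
  by have := st (Ordinal (s_n i i_s)); rewrite !inE; apply.
by rewrite !inE => /st.
Qed.

Definition code (C : {set graph}) : seq nat := [seq val x | x <- enum C].

(** Tables are searched by equality of lists, so each cop set needs one canonical list; by
    [code_vset] it is the one that [code] yields. *)
Definition sorted_code (s : seq nat) : seq nat := [seq i <- iota 0 n | i \in s].

Lemma codeK C : vset (code C) = C.
Proof. by apply/setP=> x; rewrite inE mem_map ?mem_enum //; apply: val_inj. Qed.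

Lemma component_codeP C (x : 'I_n) :
  strong_component C (x : graph) = vset (component (code C) x).
Proof. by rewrite -componentP codeK. Qed.

Lemma code_vset s : code (vset s) = sorted_code s.
Proof.
rewrite /code /sorted_code -val_enum_ord filter_map {1}enumT; congr map.
by apply: eq_filter => x; rewrite /= inE.
Qed.

Section WinningTable.
Variables (k : nat) (L : seq (seq nat * seq nat * seq nat)).

(** The index serves two ends: it equals [size L] exactly off the table, and it must grow in each
    round, which gives the rank of [robber_monotone_winI]. *)
Definition lookup (X : seq nat) (i : nat) : nat :=
  find (fun e => (X == e.1.1) && (i \in e.1.2)) L.

Definition table_move X i : seq nat := (nth ([::], [::], [::]) L (lookup X i)).2.

Definition winning_table : bool :=
  [&& all (fun e => size e.2 <= k) L,
      all (fun i => lookup [::] i < size L) (iota 0 n)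
    & all (fun e => all (fun i =>
        let X := e.1.1 in let Y := table_move X i in
        all (fun j => (j \in Y) ||
          [&& lookup X i < lookup (sorted_code Y) j,
              lookup (sorted_code Y) j < size L
            & all (mem (component X i)) (component Y j)])
          (component [seq h <- X | h \in Y] i)) e.1.2) L].

Lemma winning_tableP : winning_table -> robber_monotone_win k graph.
Proof.
case/and3P=> /allP size_L /allP init_L /allP step_L.
pose look (p : position graph) := lookup (code p.1) (val p.2).
apply: (@robber_monotone_winI _ _
  (fun p => vset (table_move (code p.1) (val p.2)))
  (fun p => look p < size L) (fun p => size L - look p)).
- move=> p; apply: leq_trans (card_vset _) _; rewrite /table_move.
  case: (ltnP (lookup (code p.1) (val p.2)) (size L)) => [lt_p | ge_p].
    exact/size_L/mem_nth.
  (* Off the table the default move is the empty cop set, which respects the bound. *)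
  by rewrite nth_default.
- move=> v; rewrite /look /= /code enum_set0; apply: init_L.
  by rewrite mem_iota ltn_ord.
move=> [C w] v; rewrite /look /= => lt_w.
have /hasP[e eL /andP[/eqP Ce we]] :
  has (fun e => (code C == e.1.1) && (val w \in e.1.2)) L by rewrite has_find.
have /allP/(_ _ we) /= := step_L e eL.
rewrite -Ce; set Y := table_move _ _; rewrite -[C in C :&: _]codeK vset_filter componentP.
move=> /allP step_w; rewrite inE => /step_w; rewrite inE => + vY.
rewrite (negbTE vY) /= code_vset => /and3P[lt_wv lt_v sub_v].
split=> //; first by rewrite ltn_sub2l.
rewrite componentP component_codeP vset_sub //.
by move=> i; apply: component_sub.
Qed.

End WinningTable.

Section TrapTable.
Variables (k : nat) (L : seq (seq nat * seq nat)).

Definition in_table (X : seq nat) (i : nat) : bool :=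
  has (fun e => (X == e.1) && (i \in e.2)) L.

(** The three conjuncts check, entry by entry, the last three hypotheses of
    [not_robber_monotone_winI]. *)
Definition trap_table : bool :=
  all (fun e => all (fun i =>
    [&& i \notin e.1,
        all (fun c => let Y := [seq h <- e.1 | h != c] in
          (c \in component Y i) || in_table (sorted_code Y) i) e.1
      & (size e.1 < k) ==>
        let R := component e.1 i in
        all (fun c => has (in_table (sorted_code (c :: e.1))) R) (free e.1)])
    e.2) L.

Lemma trap_tableP (v0 : 'I_n) :
  trap_table -> in_table [::] v0 -> component [::] v0 = iota 0 n ->
  ~ robber_monotone_win k graph.
Proof.
move=> /allP step_L init_L conn_v0.
have step (C : {set graph}) w : in_table (code C) (val w) -> exists2 e, e \in L
  & code C = e.1 /\ val w \in e.2.
  by case/hasP=> e eL /andP[/eqP Ce we]; exists e.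
apply: (@not_robber_monotone_winI _ _
  (fun p => in_table (code p.1) (val p.2)) (v0 : graph)).
- by rewrite /code /= enum_set0.
- have -> : set0 = vset [::] by apply/setP=> x; rewrite !inE.
  by rewrite componentP conn_v0; apply/setP=> x; rewrite !inE mem_iota (ltn_ord x).
- move=> C w /step[e eL [Ce we]]; have /allP/(_ _ we)/and3P[wC _ _] := step_L e eL.
  by rewrite -[C]codeK inE Ce.
- move=> C w c cC /step[e eL [Ce we]].
  have /allP/(_ _ we)/and3P[_ /allP step_w _] := step_L e eL.
  have -> : C :\ c = vset [seq h <- e.1 | h != val c].
    by apply/setP=> x; rewrite -Ce -{1}[C]codeK !inE mem_filter.
  rewrite -[C]codeK Ce inE in cC; have := step_w _ cC.
  rewrite /= componentP code_vset inE => /orP[]; last by right.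
  by left.
move=> C w c cC Ck /step[e eL [Ce we]].
have /allP/(_ _ we)/and3P[_ _ step_w] := step_L e eL.
rewrite -Ce {1}/code size_map -cardE Ck /= in step_w.
have cC' : val c \in free (code C) by rewrite mem_free; move: cC; rewrite -{1}[C]codeK inE.
have /hasP[j j_in j_tab] := allP step_w _ cC'.
have j_n := component_sub j_in; exists (Ordinal j_n : graph).
  by rewrite component_codeP inE.
have -> : c |: C = vset (val c :: code C); last by rewrite code_vset.
by apply/setP=> x; rewrite -{1}[C]codeK !inE.
Qed.

End TrapTable.

End FiniteGraphs.

(** * Contraction of an edge into the last vertex *)

Section MergeLast.
Variables (n : nat) (u : 'I_n) (E : seq (nat * nat)).

Definition merge_last (i : nat) : nat := if i == n then val u else i.

Definition merged_edges : seq (nat * nat) :=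
  [seq (merge_last e.1, merge_last e.2) | e <- E].

Lemma contraction_last :
  all (fun e => (e.1 <= n) && (e.2 <= n)) E ->
  @contraction (graph n.+1 E) (widen_ord (leqnSn n) u) ord_max
    (graph n merged_edges).
Proof.
move=> /allP E_n.
(* The only value out of range is [n], which [insubd] sends to its default [u]. *)
pose phi (x : graph n.+1 E) : graph n merged_edges := insubd u (val x).
have phiE x : val (phi x) = merge_last (val x).
  by rewrite val_insubd /merge_last ltn_neqAle -ltnS ltn_ord andbT; case: eqP.
have phi_small (i : 'I_n) : phi (widen_ord (leqnSn n) i) = i.
  by apply: val_inj; rewrite phiE /merge_last /= ltn_eqF.
exists phi; split.
- by move=> a; exists (widen_ord (leqnSn n) a).
- move=> x y; split.
    move=> /(congr1 val); rewrite !phiE /merge_last.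
    case: eqP => xn; case: eqP => yn xy.
    + by apply: Or31; apply: val_inj; rewrite xn yn.
    + by apply: Or33; split; apply: val_inj.
    + by apply: Or32; split; apply: val_inj.
    + by apply: Or31; apply: val_inj.
  have phi_max : phi ord_max = u by apply: val_inj; rewrite phiE /merge_last eqxx.
  by case=> [-> | [-> ->] | [-> ->]]; rewrite ?phi_max ?phi_small.
move=> a b; split.
  move=> /andP[ab /mapP[[i j] ij_E [ai bj]]].
  split; first by move=> ab'; rewrite ab' eqxx in ab.
  have /andP[/= i_n j_n] := E_n _ ij_E.
  exists (Ordinal (i_n : i < n.+1)), (Ordinal (j_n : j < n.+1)).
  split.
  - by apply: val_inj; rewrite phiE; apply: esym ai.
  - by apply: val_inj; rewrite phiE; apply: esym bj.
  (* The images of i and j differ, so i and j differ and the pair is not discarded as a loop. *)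
  rewrite /edge /= /graph_edge /arc /= ij_E andbT; apply: contra ab => /eqP ij.
  by apply/eqP; rewrite [LHS]ai [RHS]bj /= ij.
case=> ab [x [y [phix phiy /andP[_ xy_E]]]].
apply/andP; split; first by apply/eqP=> /val_inj.
by apply/mapP; exists (val x, val y) => //=; rewrite -phix -phiy !phiE.
Qed.

End MergeLast.

(** * The two digraphs and their certificates *)

Definition split_edges : seq (nat * nat) :=
  [:: (0, 3); (0, 6); (1, 0); (1, 4); (1, 6); (2, 0); (2, 3); (2, 5); (3, 0);
      (3, 2); (3, 5); (4, 1); (4, 7); (5, 1); (5, 3); (5, 6); (6, 0); (6, 1);
      (6, 4); (7, 2); (7, 3)].

Definition merge_edges : seq (nat * nat) :=
  @merged_edges 7 (@Ordinal 7 4 isT) split_edges.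

(* Entries (C, R, C'): with cops on C and robber space R, move to C'. *)
Definition split_strategy : seq (seq nat * seq nat * seq nat) :=
  [:: ([::], iota 0 8, [:: 0; 3; 7]);
      ([:: 0; 3; 7], [:: 1; 4; 6], [:: 0; 5; 7]);
      ([:: 0; 5; 7], [:: 1; 4; 6], [:: 0; 5; 6]);
      ([:: 0; 5; 6], [:: 1; 4], [:: 1; 5; 6]);
      ([:: 1; 5; 6], [:: 4], [:: 1; 4; 6]);
      ([:: 0; 3; 7], [:: 2], [:: 2; 3; 7]);
      ([:: 0; 3; 7], [:: 5], [:: 3; 5; 7])].

(* Entries (C, v): with cops on C, the robber survives in the strong component
   of v. *)
Definition merge_trap_points : seq (seq nat * nat) :=
  [:: ([::], 0); ([:: 0], 1); ([:: 1], 0); ([:: 2], 0); ([:: 3], 0); ([:: 4], 0);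
      ([:: 5], 0); ([:: 6], 0); ([:: 0; 1], 2); ([:: 0; 2], 1); ([:: 0; 3], 1);
      ([:: 0; 4], 1); ([:: 0; 5], 2); ([:: 0; 6], 1); ([:: 1; 2], 0);
      ([:: 1; 3], 0); ([:: 1; 4], 0); ([:: 1; 5], 0); ([:: 1; 6], 0);
      ([:: 2; 3], 0); ([:: 2; 4], 0); ([:: 2; 5], 0); ([:: 2; 6], 0);
      ([:: 3; 4], 0); ([:: 3; 5], 0); ([:: 3; 6], 1); ([:: 4; 5], 0);
      ([:: 4; 6], 0); ([:: 5; 6], 0); ([:: 0; 1; 2], 3); ([:: 0; 1; 3], 2);
      ([:: 0; 1; 4], 6); ([:: 0; 1; 5], 2); ([:: 0; 1; 6], 2); ([:: 0; 2; 3], 1);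
      ([:: 0; 2; 4], 1); ([:: 0; 2; 5], 3); ([:: 0; 2; 6], 1); ([:: 0; 3; 4], 1);
      ([:: 0; 3; 5], 2); ([:: 0; 3; 6], 1); ([:: 0; 4; 5], 1); ([:: 0; 4; 5], 2);
      ([:: 0; 4; 6], 1); ([:: 0; 5; 6], 2); ([:: 1; 2; 3], 4); ([:: 1; 2; 4], 0);
      ([:: 1; 2; 5], 0); ([:: 1; 2; 6], 0); ([:: 1; 3; 4], 0); ([:: 1; 3; 5], 0);
      ([:: 1; 3; 6], 2); ([:: 1; 4; 5], 0); ([:: 1; 4; 6], 0); ([:: 1; 5; 6], 0);
      ([:: 2; 3; 4], 0); ([:: 2; 3; 5], 0); ([:: 2; 3; 6], 1); ([:: 2; 4; 5], 0);
      ([:: 2; 4; 6], 0); ([:: 2; 5; 6], 0); ([:: 3; 4; 5], 0); ([:: 3; 4; 6], 1);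
      ([:: 3; 5; 6], 2); ([:: 4; 5; 6], 0)].

(** When a cop is lifted the robber stays on his vertex, which need not be the listed one, so whole
    components are entered. Closure under additions makes every set of at most three vertices
    occur. *)
Definition merge_trap : seq (seq nat * seq nat) :=
  [seq (e.1, component 7 merge_edges e.1 e.2) | e <- merge_trap_points].

Lemma split_win : robber_monotone_win 3 (graph 8 split_edges).
Proof. by apply: (@winning_tableP _ _ _ split_strategy); vm_compute. Qed.

Lemma merge_no_win : ~ robber_monotone_win 3 (graph 7 merge_edges).
Proof. by apply: (@trap_tableP _ _ _ merge_trap ord0); vm_compute. Qed.

Theorem theorem4p17 :
  exists (D D' : digraph) (k : nat),
    [/\ butterfly_minor D' D,
        robber_monotone_win k D
      & ~ robber_monotone_win k D'].
Proof.
exists (graph 8 split_edges), (graph 7 merge_edges), 3.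
split; [| exact: split_win | exact: merge_no_win].
(* Nothing is deleted: the minor arises by contracting (4, 7) alone. *)
exists (graph 8 split_edges); split; first by exists id; split=> // x y.
apply: butterfly_contracts_step (butterfly_contracts_refl _) _
  (contraction_last _ _) => //.
split=> //; right => w /andP[_ w7]; apply: val_inj => /=.
have /allP/(_ _ w7)/= /eqP // :
  all (fun e => (e.2 == 7) ==> (e.1 == 4)) split_edges by [].
Qed.
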